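(* Let $F:\mathbb{R}^d\to\mathbb{R}^d$ be continuous and monotone, let $H:\mathbb{R}^d\rightrightarrows\mathbb{R}^d$ be maximally monotone, and let $z^*$ satisfy $0\in F(z^* )+H(z^* )$. Let $z_0\in\mathbb{R}^d$, let $\{a_k\}_{k\ge0}$ be any sequence of positive step sizes, let $A_k=\sum_{i=0}^{k-1}a_i$ with $A_0=0$, and let $\{z_k\}$ be generated by the anchored proximal point method $$z_{k+1}=(I+a_k(F+H))^{-1}\left(\frac{a_k}{A_k+a_k}z_0+\frac{A_k}{A_k+a_k}z_k\right),\qquad k\ge0.$$ Define $$v_{k+1}:=\frac1{a_k}\left(\frac{a_k}{A_k+a_k}z_0+\frac{A_k}{A_k+a_k}z_k-z_{k+1}-a_kF(z_{k+1})\right)\in H(z_{k+1}).$$ Then for every $k\ge0$, $$\mathrm{res}^{\mathrm{tan}}(z_{k+1})\le\|F(z_{k+1})+v_{k+1}\|\le\frac{2\|z_0-z^*\|}{A_{k+1}}.$$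
   Context: Norms are Euclidean; $I$ is the identity on $\mathbb{R}^d$. The tangent residual is $\mathrm{res}^{\mathrm{tan}}(z)=\inf_{v\in H(z)}\|F(z)+v\|$. *)

(* Defs.v *)
From HB Require Import structures.
From mathcomp Require Import all_boot all_order all_algebra.
From mathcomp Require Import all_classical all_reals all_analysis.

Set Implicit Arguments.
Unset Strict Implicit.
Unset Printing Implicit Defensive.

Import Order.TTheory GRing.Theory Num.Theory.
Import numFieldNormedType.Exports.

Local Open Scope classical_set_scope.
Local Open Scope ring_scope.

Definition dotp {R : realType} {d : nat} (x y : 'rV[R]_d) : R :=
  \sum_(i < d) x 0 i * y 0 i.

(* The norm `|x| that the library puts on 'rV[R]_d is the sup norm; it induces
   the same topology as the Euclidean norm, so [continuous] is unaffected. *)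
Definition enorm {R : realType} {d : nat} (x : 'rV[R]_d) : R :=
  Num.sqrt (dotp x x).

Section SetValued.
Context {R : realType} {d : nat}.
Local Notation V := 'rV[R]_d.
Implicit Types (T S : V -> set V) (f : V -> V).

Definition single f : V -> set V := fun z => [set f z].

Definition opadd T S : V -> set V :=
  fun z => [set u + v | u in T z & v in S z].

Definition opscale (a : R) T : V -> set V := fun z => [set a *: u | u in T z].

Definition opinv T : V -> set V := fun w => [set z | T z w].

Definition resolvent (a : R) T : V -> set V :=
  opinv (opadd (single id) (opscale a T)).

Definition monotone_op T : Prop :=
  forall x y u v, T x u -> T y v -> 0 <= dotp (u - v) (x - y).

Definition maximally_monotone T : Prop :=
  monotone_op T /\
  forall S, monotone_op S -> (forall z, T z `<=` S z) -> forall z, S z `<=` T z.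

(* Extended-real valued: the infimum is +oo where [H z] is empty, whereas the
   real-valued [inf] of the empty set would be 0. *)
Definition res_tan f (H : V -> set V) (z : V) : \bar R :=
  ereal_inf [set (enorm (f z + v))%:E | v in H z].

End SetValued.

Definition step_sum {R : realType} (a : nat -> R) (k : nat) : R :=
  \sum_(0 <= i < k) a i.

Definition anchor_point {R : realType} {d : nat} (a : nat -> R)
    (z : nat -> 'rV[R]_d) (k : nat) : 'rV[R]_d :=
  (a k / (step_sum a k + a k)) *: z 0%N
  + (step_sum a k / (step_sum a k + a k)) *: z k.

(* Main.v *)
(* Write g_k for the element F z_k + v_k of (F + H) z_k and A_k for the sum of
   the first k steps. The energy A_k^2 / 2 |g_k|^2 + A_k <g_k, z_k - z_0> does
   not increase, by monotonicity between consecutive iterates, and is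
   nonpositive at k = 1. Monotonicity against z* then gives
   A_k / 2 |g_k|^2 <= <g_k, z_0 - z*>, whence |g_k| <= 2 |z_0 - z*| / A_k. *)
Require Import Defs.
From HB Require Import structures.
From mathcomp Require Import all_boot all_order all_algebra.
From mathcomp Require Import ring lra.
From mathcomp Require Import all_classical all_reals all_analysis.
Import Order.TTheory GRing.Theory Num.Theory.
Import numFieldNormedType.Exports.
Local Open Scope classical_set_scope.
Local Open Scope ring_scope.

Section DotProduct.
Context {R : realType} {d : nat}.
Implicit Types x y z : 'rV[R]_d.

Lemma dotpC x y : dotp x y = dotp y x.
Proof. by apply: eq_bigr => i _; rewrite mulrC. Qed.

Lemma dotpDl x y z : dotp (x + y) z = dotp x z + dotp y z.
Proof. by rewrite -big_split; apply: eq_bigr => i _; rewrite mxE mulrDl. Qed.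

Lemma dotpZl (c : R) x y : dotp (c *: x) y = c * dotp x y.
Proof. by rewrite mulr_sumr; apply: eq_bigr => i _; rewrite mxE mulrA. Qed.

Lemma dotpNl x y : dotp (- x) y = - dotp x y.
Proof. by rewrite -scaleN1r dotpZl mulN1r. Qed.

Lemma dotpBl x y z : dotp (x - y) z = dotp x z - dotp y z.
Proof. by rewrite dotpDl dotpNl. Qed.

Lemma dotpDr x y z : dotp x (y + z) = dotp x y + dotp x z.
Proof. by rewrite dotpC dotpDl !(dotpC _ x). Qed.

Lemma dotpZr (c : R) x y : dotp x (c *: y) = c * dotp x y.
Proof. by rewrite dotpC dotpZl dotpC. Qed.

Lemma dotpBr x y z : dotp x (y - z) = dotp x y - dotp x z.
Proof. by rewrite dotpC dotpBl !(dotpC _ x). Qed.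

Lemma dotp0r x : dotp x 0 = 0.
Proof. by rewrite -(scale0r x) dotpZr mul0r. Qed.

Lemma dotp_ge0 x : 0 <= dotp x x.
Proof. by apply: sumr_ge0 => i _; rewrite -expr2 sqr_ge0. Qed.

(** Both sides are nonnegative, so squares can be compared instead; this keeps the final estimate
    polynomial in inner products. *)
Lemma le_enormM (c : R) x y : 0 <= c ->
  c ^+ 2 * dotp x x <= dotp y y -> c * enorm x <= enorm y.
Proof.
move=> c0 h; rewrite /enorm -{1}(ger0_norm c0) -sqrtr_sqr -sqrtrM ?sqr_ge0 //.
exact: ler_wsqrtr.
Qed.

End DotProduct.

Lemma monotone_opadd {R : realType} {d : nat} (T S : 'rV[R]_d -> set 'rV[R]_d) :
  monotone_op T -> monotone_op S -> monotone_op (opadd T S).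
Proof.
move=> mT mS x y _ _ [t Tt [s Ss <-]] [t' Tt' [s' Ss' <-]].
rewrite opprD addrACA dotpDl; apply: addr_ge0; [exact: mT | exact: mS].
Qed.

Definition anchored_energy {R : realType} {d : nat} (A : R) (g w : 'rV[R]_d) : R :=
  A ^+ 2 / 2 * dotp g g + A * dotp g w.

(** Here [w] and [w'] are displacements from the anchor. Pairing the update with [g] and [g']
    eliminates [w]. The energy change is then a nonpositive multiple of the monotonicity term minus
    half of |(A + a) g' - A g|^2. *)
Lemma anchored_energy_step {R : realType} {d : nat} (A a : R)
    (g g' w w' : 'rV[R]_d) : 0 < A -> 0 < a ->
  (A + a) *: w' + (a * (A + a)) *: g' = A *: w ->
  0 <= dotp (g' - g) (w' - w) ->
  anchored_energy (A + a) g' w' <= anchored_energy A g w.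
Proof.
move=> A0 a0 e mono.
have eg : (A + a) * dotp g w' + a * (A + a) * dotp g g' = A * dotp g w.
  by rewrite -!dotpZr -dotpDr e.
have eg' : (A + a) * dotp g' w' + a * (A + a) * dotp g' g' = A * dotp g' w.
  by rewrite -!dotpZr -dotpDr e.
(* After multiplication by A, [eg] and [eg'] turn [mono] into -a times this expression. *)
have mono' : dotp g' w' - dotp g w' + (A + a) * (dotp g' g' - dotp g g') <= 0.
  rewrite -(pmulr_rle0 _ a0).
  have := mulr_ge0 (ltW A0) mono; rewrite !dotpBl !dotpBr; lra.
have /(mulr_ge0_le0 (ltW (addr_gt0 A0 a0))) := mono'.
have := dotp_ge0 ((A + a) *: g' - A *: g).
rewrite !dotpBl !dotpBr !dotpZl !dotpZr (dotpC g' g) /anchored_energy; lra.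
Qed.

(** Meant for w = z_k - z_0 and u = z_0 - z*, so that w + u = z_k - z*. The hypotheses give A^2 / 2
    |g|^2 <= A <g, u>, and expanding |u - (A / 2) g|^2 >= 0 then yields A^2 / 4 |g|^2 <= |u|^2
    without Cauchy-Schwarz. *)
Lemma anchored_energy_le0_bound {R : realType} {d : nat} (A : R)
    (g w u : 'rV[R]_d) : 0 < A ->
  anchored_energy A g w <= 0 -> 0 <= dotp g (w + u) ->
  enorm g <= 2 * enorm u / A.
Proof.
move=> A0; rewrite /anchored_energy dotpDr => E0 mono.
have half : A / 2 * enorm g <= enorm u.
  apply: le_enormM; first by rewrite divr_ge0 ?ltW.
  have := dotp_ge0 (u - (A / 2) *: g).
  have := mulr_ge0 (ltW A0) mono.
  rewrite !dotpBl !dotpBr !dotpZl !dotpZr (dotpC u g); lra.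
by rewrite ler_pdivlMr //; lra.
Qed.

Lemma step_sumS {R : realType} (a : nat -> R) k :
  step_sum a k.+1 = step_sum a k + a k.
Proof. by rewrite /step_sum big_nat_recr. Qed.

Lemma step_sum_gt0 {R : realType} (a : nat -> R) k :
  (forall i, 0 < a i) -> 0 < step_sum a k.+1.
Proof.
move=> a0; elim: k => [|k IH]; rewrite step_sumS; last exact: addr_gt0.
by rewrite /step_sum big_nil add0r.
Qed.

Theorem proposition3p1 (R : realType) (d : nat)
    (F : 'rV[R]_d -> 'rV[R]_d) (H : 'rV[R]_d -> set 'rV[R]_d)
    (zstar : 'rV[R]_d) (a : nat -> R) (z v : nat -> 'rV[R]_d)
    (F_continuous : continuous F)
    (F_monotone : monotone_op (single F))
    (H_maxmono : maximally_monotone H)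
    (zstar_zero : opadd (single F) H zstar 0)
    (a_pos : forall k : nat, 0 < a k)
    (z_step : forall k : nat,
      resolvent (a k) (opadd (single F) H) (anchor_point a z k) (z k.+1))
    (v_def : forall k : nat,
      v k.+1 = (a k)^-1 *: (anchor_point a z k - z k.+1 - a k *: F (z k.+1))) :
  forall k : nat,
    [/\ H (z k.+1) (v k.+1),
        (res_tan F H (z k.+1) <= (enorm (F (z k.+1) + v k.+1))%:E)%E
      & enorm (F (z k.+1) + v k.+1)
          <= 2 * enorm (z 0%N - zstar) / step_sum a k.+1].
Proof.
(* The index is shifted: [g k] belongs to the iterate [z k.+1]. *)
set g := fun k => F (z k.+1) + v k.+1.
have Hv k : H (z k.+1) (v k.+1).
  rewrite v_def.
  (* Resolvent membership says that the anchor point is z_{k+1} + a_k (F z_{k+1} + h) with h in H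
     z_{k+1}; solving for h gives exactly v_{k+1}. *)
  case: (z_step k) => _ -> [_ [_ [_ -> [h Hh <-]] <-] e].
  rewrite -e /= (addrC (z k.+1)) addrK -scalerBr (addrC (F _)) addrK scalerA mulVf ?scale1r //.
  exact: lt0r_neq0.
have mono := monotone_opadd _ _ F_monotone H_maxmono.1.
have Tg k : opadd (single F) H (z k.+1) (g k).
  by exists (F (z k.+1)) => //; exists (v k.+1).
(* The update a_k g = anchor point - z_{k+1}, cleared of its denominator A_{k+1} and recentred at
   z_0. *)
have rec k : step_sum a k.+1 *: (z k.+1 - z 0%N)
    + (a k * step_sum a k.+1) *: g k = step_sum a k *: (z k - z 0%N).
  have A0 := lt0r_neq0 (step_sum_gt0 a k a_pos); have a0 := lt0r_neq0 (a_pos k).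
  rewrite step_sumS in A0 *.
  rewrite /g v_def /anchor_point; apply/rowP => i; rewrite !mxE.
  by field; rewrite a0 A0.
have E0 k : anchored_energy (step_sum a k.+1) (g k) (z k.+1 - z 0%N) <= 0.
  elim: k => [|k IH].
    (* Since A_0 = 0, the right side of [rec] vanishes and the first energy equals -a_0^2 / 2
       |g_1|^2. *)
    have := congr1 (dotp (g 0%N)) (rec 0%N).
    rewrite subrr scaler0 step_sumS /step_sum big_nil add0r dotpDr !dotpZr dotp0r.
    by have := dotp_ge0 (a 0%N *: g 0%N); rewrite dotpZl dotpZr /anchored_energy; lra.
  apply: le_trans IH; rewrite step_sumS; apply: anchored_energy_step => //.
  - exact: step_sum_gt0.
  - by rewrite -step_sumS rec.
  - by rewrite opprB addrA subrK; apply: mono.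
move=> k; split=> //.
  by apply: ereal_inf_lbound; exists (v k.+1).
apply: (anchored_energy_le0_bound _ _ _ _ (step_sum_gt0 a k a_pos) (E0 k)).
(* The subtracted 0 is the element of (F + H) z* supplied by [zstar_zero]. *)
rewrite addrA subrK -[g k]subr0; exact: mono.
Qed.
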